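(* Let $F$ be a finite field of prime order $q$, $n\ge 1$, let $\mathcal{C}\subseteq M_n(F)$ be a similarity class with minimal polynomial $\mu$, and let $S$ be a nonempty subset of $\mathcal{C}$. Let $m\in F[x]$ be a monic irreducible polynomial of degree $s\ge 2$ with $m\mid\mu$, let $K$ be the splitting field of $m$ over $F$, let $\alpha\in K$ be a root of $m$, and put $f_\alpha=\mu/(x-\alpha)\in K[x]$. Then $$\bigcap_{A\in S}\mathcal{B}_F\Big(A,\frac{\mu}{m}\Big)=\{0\}\iff\bigcap_{A\in S}\mathcal{B}_K(A,f_\alpha)=\{0\}\iff\sum_{A\in S}\operatorname{Im}_K f_\alpha(A)=K^n.$$
   Context: A similarity class is an orbit of $M_n(F)$ under conjugation by $\mathrm{GL}(n,F)$; $\mu\in F[x]$ is the common minimal polynomial of its elements. For a field $L$, in $M_n(L)[x]$ the indeterminate $x$ commutes with all coefficients, $L[x]\subseteq M_n(L)[x]$ via scalar matrices, and evaluation is with $x$ to the right of the coefficients: for $f=\sum_k B_kx^k$ and $A\in M_n(L)$, $f(A)=\sum_k B_kA^k$. For $A\in M_n(L)$ with minimal polynomial $m_A$ and $g\in L[x]$ with $g\mid m_A$, $\mathcal{B}_L(A,g)=\{f\in M_n(L)[x] : (fg)(A)=0,\ \deg f<\deg m_A-\deg g\}$ (the zero polynomial is always included, with $\deg 0=-\infty$). Matrices in $M_n(F)$ are regarded as elements of $M_n(K)$ when $L=K$. $\operatorname{Im}_K B$ is the image of $K^n\to K^n$, $v\mapsto Bv$. *)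

(* Defs.v *)
From HB Require Import structures.
From mathcomp Require Import all_boot all_order all_fingroup all_algebra all_field.

Set Implicit Arguments.
Unset Strict Implicit.
Unset Printing Implicit Defensive.

Import GRing.Theory.
Local Open Scope ring_scope.

Definition similarity_class (F : finFieldType) (n : nat) (A : 'M[F]_n.+1) :
    {set 'M[F]_n.+1} :=
  [set GLval P *m A *m invmx (GLval P) | P : {'GL_n.+1[F]}].

(* [horner] on {poly 'M_n.+1} puts the powers of the point to the right of the
   coefficients.  Since [size p] is the degree plus 1 (and 0 for p = 0), the
   bound deg f < deg m_A - deg g, for g nonzero dividing m_A, is
   [size f <= size m_A - size g]; it allows only f = 0 when the degrees of g
   and m_A agree. *)
Definition annB (L : fieldType) (n : nat) (A : 'M[L]_n.+1) (g : {poly L}) :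
    pred {poly 'M[L]_n.+1} :=
  [pred f | ((f * map_poly (@scalar_mx L n.+1) g).[A] == 0)
            && (size f <= size (mxminpoly A) - size g)%N].

(* The image of v |-> B v on column vectors. *)
Definition imgmx (L : fieldType) (n : nat) (B : 'M[L]_n.+1) :
    {vspace 'cV[L]_n.+1} :=
  limg (linfun (mulmx B)).

(* Main.v *)
(* Write g = mu / m and m = h (x - alpha), so that f_alpha = g h.  Since A acts
   as alpha on the image of f_alpha(A), every matrix polynomial f over F
   satisfies f(alpha) f_alpha(A) = f(A) g(A) h(A), and the factor h(A) can be
   cancelled because f(A) g(A) has entries in F and is killed by m(A).  As F is
   finite, K = F(alpha), so f |-> f(alpha) is a bijection from the matrix
   polynomials over F of degree < s onto M_n(K); it matches the first
   intersection with the second, whose elements are the constants B with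
   B f_alpha(A) = 0 for all A in S, i.e. the B vanishing on the sum of the
   images. *)
Require Import Defs.
From HB Require Import structures.
From mathcomp Require Import all_boot all_order all_fingroup all_algebra all_field.

Set Implicit Arguments.
Unset Strict Implicit.
Unset Printing Implicit Defensive.

Import GRing.Theory.
Local Open Scope ring_scope.

(** * The field generated by one root *)

Lemma irreducible_poly_dvd_root (F K : fieldType) (iota : {rmorphism F -> K})
    (m p : {poly F}) (a : K) :
  irreducible_poly m -> root (map_poly iota m) a -> root (map_poly iota p) a ->
  m %| p.
Proof.
move=> m_irr m_a p_a; apply: contraLR p_a => m'p.
rewrite rootE; apply: coprimep_root m_a.
by rewrite coprimep_map irreducible_poly_coprime.
Qed.

(* The roots of m are fixed by the power of the Frobenius map that fixes
   F(alpha), so F(alpha) contains them all. *)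
Lemma splitting_finField_adjoin_root (F : finFieldType) (K : fieldExtType F)
    (m : {poly F}) (alpha : K) :
  irreducible_poly m ->
  splittingFieldFor 1%VS (map_poly (in_alg K) m) {:K}%VS ->
  root (map_poly (in_alg K) m) alpha ->
  <<1; alpha>>%VS = {:K}%VS.
Proof.
move=> m_irr [rs m_rs K_rs] m_alpha; apply/eqP.
rewrite eqEsubv subvf -{1}K_rs; apply/Fadjoin_seqP; split=> [|b].
  exact: sub1v.
rewrite -root_prod_XsubC -(eqp_root m_rs) => m_b.
rewrite Fermat's_little_theorem; set N := (#|F| ^ _)%N.
have rootE c : root (map_poly (in_alg K) ('X^N - 'X)) c = (c ^+ N == c).
  by rewrite rmorphB /= map_polyXn map_polyX rootE !hornerE subr_eq0.
(* ['X^N - 'X] has coefficients in F, so the irreducible [m] divides it as soon as they share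
   [alpha]; then [b] is fixed as well. *)
have m_dvd : m %| 'X^N - 'X.
  apply: (irreducible_poly_dvd_root m_irr m_alpha).
  by rewrite rootE -Fermat's_little_theorem memv_adjoin.
by rewrite -rootE; apply: root_dvdp m_b; rewrite dvdp_map.
Qed.

Lemma adjoin_root_polyP (F : fieldType) (K : fieldExtType F) (m : {poly F})
    (alpha : K) :
  m != 0 -> root (map_poly (in_alg K) m) alpha -> <<1; alpha>>%VS = {:K}%VS ->
  forall x : K, exists p : {poly F},
    (size p < size m)%N && ((map_poly (in_alg K) p).[alpha] == x).
Proof.
move=> m_neq0 /eqP m_alpha K_alpha x.
have : x \in <<1; alpha>>%VS by rewrite K_alpha memvf.
case/Fadjoin_polyP=> _ /polyOver1P[p ->] ->.
exists (p %% m); rewrite ltn_modp m_neq0 /=.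
by rewrite {2}(divp_eq p m) rmorphD rmorphM /= !hornerE m_alpha mulr0 add0r.
Qed.

Lemma size_poly_root_eq0 (F K : fieldType) (iota : {rmorphism F -> K})
    (m p : {poly F}) (a : K) :
  irreducible_poly m -> root (map_poly iota m) a -> (size p < size m)%N ->
  root (map_poly iota p) a -> p = 0.
Proof.
move=> m_irr m_a ltpm /(irreducible_poly_dvd_root m_irr m_a) m_dvd.
by apply: contraTeq ltpm => p_neq0; rewrite -leqNgt dvdp_leq.
Qed.

(** * Matrix polynomials at a scalar point *)

Section MatrixPolynomials.

Variables (F K : fieldType) (iota : {rmorphism F -> K}) (n : nat).

(** Powers of a scalar matrix are scalar, so evaluation at [a%:M] reduces to one polynomial over F
    for each entry. *)
Lemma horner_map_mxE (f : {poly 'M[F]_n.+1}) (a : K) i j :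
  (map_poly (map_mx iota) f).[a%:M] i j =
  (map_poly iota (\poly_(k < size f) f`_k i j)).[a].
Proof.
rewrite (@horner_coef_wide _ (size f)) ?size_poly //.
rewrite [RHS](@horner_coef_wide _ (size f)); last first.
  exact: leq_trans (size_poly _ _) (size_poly _ _).
rewrite summxE; apply: eq_bigr => k _; rewrite !coef_map /= coef_poly ltn_ord.
by rewrite -rmorphXn /= [_ * _]mul_mx_scalar !mxE mulrC.
Qed.

Lemma horner_map_mx_inj (m : {poly F}) (a : K) (f : {poly 'M[F]_n.+1}) :
  irreducible_poly m -> root (map_poly iota m) a -> (size f < size m)%N ->
  (map_poly (map_mx iota) f).[a%:M] = 0 -> f = 0.
Proof.
move=> m_irr m_a ltfm f_a; apply/polyP=> k; apply/matrixP=> i j.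
rewrite coef0 mxE.
have := horner_map_mxE f a i j; rewrite f_a mxE => /esym/rootP.
move/(size_poly_root_eq0 m_irr m_a (leq_ltn_trans (size_poly _ _) ltfm)).
move=> /polyP/(_ k).
by rewrite coef_poly coef0; case: ltnP => // /(nth_default 0)->; rewrite mxE.
Qed.

Lemma horner_map_mx_surj (m : {poly F}) (a : K) :
  (forall x : K, exists p : {poly F},
    (size p < size m)%N && ((map_poly iota p).[a] == x)) ->
  forall B : 'M[K]_n.+1, exists2 f : {poly 'M[F]_n.+1},
    (size f < size m)%N & (map_poly (map_mx iota) f).[a%:M] = B.
Proof.
move=> coord B; pose p i j := xchoose (coord (B i j)).
have pP i j := andP (xchooseP (coord (B i j))).
(* The k-th coefficient of [f] collects those of all [p i j]; as these have size below [size m], the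
   cut at [(size m).-1] loses nothing. *)
pose f := \poly_(k < (size m).-1) (\matrix_(i, j) (p i j)`_k) : {poly 'M_n.+1}.
have m_gt0 : (0 < size m)%N by have [/(leq_ltn_trans _)->] := pP 0 0.
have ltfm : (size f < size m)%N.
  by rewrite -(prednK m_gt0) ltnS size_poly.
exists f => //; apply/matrixP=> i j; rewrite horner_map_mxE.
have [lt_p /eqP <-] := pP i j; congr (map_poly _ _).[_].
apply/polyP=> k; rewrite coef_poly -/(p i j).
have fE: f`_k i j = (p i j)`_k.
  rewrite coef_poly; case: ltnP => [_|le_mk]; rewrite mxE //.
  by rewrite nth_default // (leq_trans _ le_mk) // -ltnS prednK.
(* Beyond [size f] the coefficient of [f] is zero, and by [fE] so is that of [p i j]. *)
by case: ltnP => [//|le_fk]; move: fE; rewrite (nth_default 0 le_fk) mxE => <-.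
Qed.

End MatrixPolynomials.

(** * Evaluation at a matrix and cancellation *)

Lemma horner_mul_eigen (R : nzRingType) (f : {poly R}) (a c w : R) :
  GRing.comm a c -> a * w = c * w -> f.[a] * w = f.[c] * w.
Proof.
move=> ac aw; rewrite !horner_coef !mulr_suml; apply: eq_bigr => k _.
(* Induction gives a^k w = c^k w; commutation moves a past the power of c. *)
rewrite -!mulrA; congr (_ * _); elim: {k}(k : nat) => [|k IHk].
  by rewrite !expr0.
rewrite exprS -mulrA IHk mulrA (commrX k ac) -mulrA aw mulrA.
by rewrite exprSr.
Qed.

(** Evaluation at [A] respects this product because g(A) commutes with [A]. *)
Lemma horner_mul_scalar_poly (L : fieldType) (n : nat) (A : 'M[L]_n.+1)
    (f : {poly 'M[L]_n.+1}) (g : {poly L}) :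
  (f * map_poly (@scalar_mx L n.+1) g).[A] = f.[A] * horner_mx A g.
Proof.
rewrite hornerM_comm //; exact/comm_mx_horner/comm_mx_refl.
Qed.

Lemma in_alg_retraction (F : fieldType) (K : fieldExtType F) :
  exists2 lambda : {scalar K}, lambda 1 = 1 &
    forall x c, lambda (x * in_alg K c) = lambda x * c.
Proof.
(* [coord] is linear on all of K, although the free family of 1 need not span it. *)
exists (coord [tuple (1 : K)] ord0) => [|x c].
  have free1 : free [tuple (1 : K)] by rewrite seq1_free oner_neq0.
  exact: coord_free ord0 ord0 free1.
by rewrite mulr_algr linearZ mulrC.
Qed.

(* An F-linear retraction of K onto F turns h into a nonzero polynomial over F
   of the same degree, hence coprime to m, that still annihilates N. *)
Lemma mul_horner_monic_eq0 (F : fieldType) (K : fieldExtType F) (n : nat)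
    (A N : 'M[F]_n.+1) (m : {poly F}) (h : {poly K}) :
  irreducible_poly m -> N * horner_mx A m = 0 ->
  h \is monic -> (size h < size m)%N ->
  map_mx (in_alg K) N * horner_mx (map_mx (in_alg K) A) h = 0 -> N = 0.
Proof.
move=> m_irr Nm h_mon lthm Nh.
have [lambda lambda1 lambdaM] := in_alg_retraction K.
pose p := map_poly lambda h.
have Np : N * horner_mx A p = 0.
  (* As [N] and [A] have entries in F, applying [lambda] to the entries of N h(A) yields those of N
     p(A). *)
  apply/matrixP=> i j; rewrite [RHS]mxE -(linear0 lambda).
  have <- : (map_mx (in_alg K) N * horner_mx (map_mx (in_alg K) A) h) i j = 0.
    by rewrite Nh mxE.
  rewrite /horner_mx /horner_morph.
  rewrite !(@horner_coef_wide _ (size h)) ?size_poly //; last first.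
    exact: leq_trans (size_poly _ _) (size_poly _ _).
  rewrite !mulr_sumr !summxE linear_sum; apply: eq_bigr => k _.
  rewrite !coef_map_id0 ?raddf0 //=.
  rewrite -rmorphXn /= ![_%:M * _]mul_scalar_mx -!scalerAr -rmorphM /=.
  by rewrite mxE [in RHS]mxE [map_mx _ _ i j]mxE lambdaM.
have p_neq0 : p != 0.
  apply/eqP=> /polyP/(_ (size h).-1); rewrite coef_map_id0 ?raddf0 // coef0.
  by rewrite -lead_coefE (monicP h_mon) lambda1 => /eqP; rewrite oner_eq0.
have : coprimep m p.
  rewrite irreducible_poly_coprime //; apply: contraL lthm => /dvdp_leq.
  by rewrite -leqNgt => /(_ p_neq0)/leq_trans-> //; apply: size_poly.
(* Bezout gives c (u m + v p) = d with c and d nonzero constants; evaluating at [A] and multiplying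
   by [N] leaves 0 = d N. *)
case/Bezout_coprimepP=> -[u v] /= /eqpP[[c d] /= /andP[c0 d0]].
move=> /(congr1 (fun r => N * horner_mx A r)).
rewrite !linearZ /= rmorph1 rmorphD !rmorphM /= -!scalerAr mulrDr mulr1.
rewrite [horner_mx A u * _]comm_horner_mx2 [horner_mx A v * _]comm_horner_mx2.
rewrite !mulrA Nm Np !mul0r addr0 scaler0.
by move/esym/eqP; rewrite scaler_eq0 (negPf d0) => /eqP.
Qed.

(** * Annihilators and images *)

Lemma in_annB (L : fieldType) (n : nat) (A : 'M[L]_n.+1) (g : {poly L})
    (f : {poly 'M[L]_n.+1}) :
  (f \in annB A g) = (f.[A] * horner_mx A g == 0)
                     && (size f <= size (mxminpoly A) - size g)%N.
Proof. by rewrite inE horner_mul_scalar_poly. Qed.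

Lemma mulmx_imgmx_eq0 (L : fieldType) (n : nat) (B M : 'M[L]_n.+1) :
  B *m M = 0 <-> {in imgmx M, forall v, B *m v = 0}.
Proof.
split=> [BM v /memv_imgP[w _ ->]|BM].
  by rewrite lfunE /= mulmxA BM mul0mx.
apply/trmx_inj/row_matrixP=> i; rewrite trmx0 row0.
rewrite -tr_col colE -mulmxA BM ?trmx0 //.
have := memv_img (linfun (mulmx M)) (memvf (delta_mx i 0 : 'cV_n.+1)).
by rewrite lfunE.
Qed.

(** [lin1_mx] represents maps of row vectors, hence the transposes. *)
Lemma matrix_of_cV_linear (L : fieldType) (n : nat)
    (f : {linear 'cV[L]_n -> 'cV[L]_n}) :
  exists B : 'M[L]_n, forall v, B *m v = f v.
Proof.
exists (lin1_mx (trmx \o f \o trmx))^T => v.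
by apply: trmx_inj; rewrite trmx_mul trmxK mul_rV_lin1 /= trmxK.
Qed.

(* If the images do not span, a projection along their span kills them all. *)
Lemma sum_imgmx_fullP (L : fieldType) (n : nat) (I : finType) (P : {pred I})
    (M : I -> 'M[L]_n.+1) :
  (\sum_(i in P) imgmx (M i))%VS = fullv <->
  (forall B : 'M[L]_n.+1, {in P, forall i, B *m M i = 0} -> B = 0).
Proof.
split=> [fullM B BM|B0].
  rewrite -[B]mulmx1; apply/mulmx_imgmx_eq0=> v _.
  have : v \in (\sum_(i in P) imgmx (M i))%VS by rewrite fullM memvf.
  case/memv_sumP=> w Mw ->; rewrite mulmx_sumr big1 // => i Pi.
  by apply: (mulmx_imgmx_eq0 B (M i)).1; rewrite ?BM ?Mw.
set U := (\sum_(i in P) _)%VS.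
have [B BE] := matrix_of_cV_linear (\1%VF - projv U).
have BEv v : B *m v = v - projv U v.
  by rewrite BE /= add_lfunE opp_lfunE id_lfunE.
have {}B0 : B = 0.
  apply: B0 => i Pi; apply/mulmx_imgmx_eq0=> v Mv.
  rewrite BEv projv_id ?subrr //.
  by apply: subvP Mv; apply: sumv_sup Pi (subvv _).
apply/vspaceP=> v; rewrite memvf.
have /eqP := BEv v; rewrite B0 mul0mx eq_sym subr_eq0 => /eqP->.
exact: memv_proj.
Qed.

(** The size bound leaves only constant polynomials, whose value at any matrix is their
    coefficient. *)
Lemma annB_trivialP (L : fieldType) (n : nat) (I : finType) (S : {set I})
    (M : I -> 'M[L]_n.+1) (g : {poly L}) :
  {in S, forall i, size (mxminpoly (M i)) - size g = 1}%N ->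
  [pred f : {poly 'M[L]_n.+1} | [forall i in S, f \in annB (M i) g]] =i pred1 0
  <-> (forall B : 'M[L]_n.+1,
         {in S, forall i, B * horner_mx (M i) g = 0} -> B = 0).
Proof.
move=> size1; split=> [ann0 B BM | B0 f].
  apply/eqP; rewrite -polyC_eq0; apply: etrans (esym (ann0 B%:P)) _.
  apply/forall_inP=> i Si; rewrite in_annB hornerC BM // eqxx size1 //.
  by rewrite size_polyC leq_b1.
rewrite !inE; apply/forall_inP/eqP=> [f_ann | -> i Si]; last first.
  by rewrite in_annB horner0 mul0r eqxx size_poly0.
(* For empty [S] the hypothesis would make the identity matrix zero. *)
have [S0 | [i Si]] := set_0Vmem S.
  by have := oner_eq0 'M[L]_n.+1; rewrite (B0 1) ?eqxx // => i; rewrite S0 inE.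
have := f_ann i Si; rewrite in_annB size1 // => /andP[_ /size1_polyC fE].
rewrite fE (B0 f`_0) // => j Sj.
by have := f_ann j Sj; rewrite in_annB fE hornerC coefC => /andP[/eqP].
Qed.

(** * Passage from F to K *)

Lemma horner_annihilator_extension (F : fieldType) (K : fieldExtType F)
    (n : nat) (m g : {poly F}) (h : {poly K}) (alpha : K)
    (A : 'M[F]_n.+1) (f : {poly 'M[F]_n.+1}) :
  irreducible_poly m -> h \is monic ->
  map_poly (in_alg K) m = h * ('X - alpha%:P) ->
  horner_mx A (g * m) = 0 ->
  f.[A] * horner_mx A g = 0 <->
  (map_poly (map_mx (in_alg K)) f).[alpha%:M]
    * horner_mx (map_mx (in_alg K) A) (map_poly (in_alg K) g * h) = 0.
Proof.
move=> m_irr h_mon mE Agm; set AK := map_mx _ A; set B := _.[alpha%:M].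
have BE : B * horner_mx AK (map_poly (in_alg K) g * h) =
    map_mx (in_alg K) (f.[A] * horner_mx A g) * horner_mx AK h.
  rewrite /B -(@horner_mul_eigen _ _ AK).
  - by rewrite horner_map rmorphM /= mulrA map_mxM map_horner_mx.
  - exact: comm_mx_scalar.
  (* (A - alpha) g(A) h(A) = g(A) m(A) = 0, so [A] acts as alpha on the image of g(A) h(A). *)
  apply/eqP; rewrite -subr_eq0 -mulrBl; apply/eqP.
  have <- : horner_mx AK ('X - alpha%:P) = AK - alpha%:M.
    by rewrite rmorphB /= horner_mx_X horner_mx_C.
  rewrite -rmorphM mulrC -mulrA -mE -rmorphM.
  by rewrite /= -map_horner_mx Agm map_mx0.
rewrite BE; split=> [->|]; first by rewrite map_mx0 mul0r.
(* The factor h(A) is cancelled: f(A) g(A) is killed by m(A), and [h] has degree one less than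
   [m]. *)
apply: (mul_horner_monic_eq0 m_irr) => //.
  by rewrite -mulrA -rmorphM /= Agm mulr0.
rewrite -(size_map_poly (in_alg K) m) mE size_monicM ?polyXsubC_eq0 //.
by rewrite size_XsubC addn2.
Qed.

Theorem theorem5p5 (F : finFieldType) (q : nat) (hF : #|F| = q) (hq : prime q)
  (n : nat) (C : {set 'M[F]_n.+1})
  (hC : exists A0 : 'M[F]_n.+1, C = similarity_class A0)
  (mu : {poly F}) (hmu : forall A : 'M[F]_n.+1, A \in C -> mxminpoly A = mu)
  (S : {set 'M[F]_n.+1}) (hSC : S \subset C) (hS0 : S != set0)
  (m : {poly F}) (s : nat) (hmonic : m \is monic) (hirr : irreducible_poly m)
  (hdeg : size m = s.+1) (hs : (2 <= s)%N) (hdvd : m %| mu)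
  (K : fieldExtType F)
  (hK : splittingFieldFor 1%VS (map_poly (in_alg K) m) {:K}%VS)
  (alpha : K) (halpha : root (map_poly (in_alg K) m) alpha)
  (falpha : {poly K})
  (hfalpha : falpha = map_poly (in_alg K) mu %/ ('X - alpha%:P)) :
  ([pred f : {poly 'M[F]_n.+1} |
      [forall A in S, f \in annB A (mu %/ m)]] =i pred1 0
   <->
   [pred f : {poly 'M[K]_n.+1} |
      [forall A in S, f \in annB (map_mx (in_alg K) A) falpha]] =i pred1 0)
  /\
  ([pred f : {poly 'M[K]_n.+1} |
      [forall A in S, f \in annB (map_mx (in_alg K) A) falpha]] =i pred1 0
   <->
   (\sum_(A in S) imgmx (horner_mx (map_mx (in_alg K) A) falpha))%VS
     = fullv).
Proof.
have Smu A : A \in S -> mxminpoly A = mu by move/(subsetP hSC)/hmu.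
have [A0 SA0] := set0Pn _ hS0.
have mu_neq0 : mu != 0 by rewrite -(Smu _ SA0) monic_neq0 ?mxminpoly_monic.
have m_neq0 := monic_neq0 hmonic.
have := halpha; rewrite -dvdp_XsubCl => /dvdpP[h mE].
have h_mon : h \is monic.
  by rewrite -(monicMr _ (monicXsubC alpha)) -mE map_monic.
have muE := divpK hdvd; set g := mu %/ m in muE *.
have faE : falpha = map_poly (in_alg K) g * h.
  by rewrite hfalpha -muE rmorphM /= mE mulrA mulpK ?polyXsubC_eq0.
(* The minimal polynomial is unchanged over K, and f_alpha has degree one less than [mu]. *)
have size_fa :
    {in S, forall A, size (mxminpoly (map_mx (in_alg K) A)) - size falpha = 1}%N.
  move=> A SA; rewrite mxminpoly_map Smu // hfalpha.
  rewrite size_divp ?polyXsubC_eq0 // size_XsubC subKn //.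
  by rewrite size_poly_gt0 map_poly_eq0.
have annK := annB_trivialP size_fa.
have annF f : (f \in [pred f : {poly 'M[F]_n.+1} |
      [forall A in S, f \in annB A g]]) <->
    (size f < size m)%N /\ {in S, forall A,
       (map_poly (map_mx (in_alg K)) f).[alpha%:M]
         * horner_mx (map_mx (in_alg K) A) falpha = 0}.
  (* The bound in [annB] becomes [size f <= (size m).-1], the range in which f is determined by
     f(alpha). *)
  have size_g : (size mu - size g)%N = (size m).-1.
    rewrite size_divp // subKn // (leq_trans (leq_pred _)) //.
    exact: dvdp_leq.
  have ltm k : (k < size m)%N = (k <= (size m).-1)%N.
    by rewrite -{1}(prednK (n := size m)) ?size_poly_gt0.
  have eqv A : A \in S -> f.[A] * horner_mx A g = 0 <-> _ := fun SA =>
    horner_annihilator_extension f hirr h_mon mE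
      (etrans (congr1 (horner_mx A) (etrans muE (esym (Smu A SA))))
              (mx_root_minpoly A)).
  rewrite faE inE; split=> [/forall_inP f_ann | [lt_fm f_ann]].
    split=> [|A SA].
      by have := f_ann _ SA0; rewrite in_annB Smu // size_g ltm => /andP[].
    by apply/eqv=> //; have := f_ann A SA; rewrite in_annB => /andP[/eqP].
  apply/forall_inP=> A SA; rewrite in_annB Smu // size_g -ltm lt_fm andbT.
  by apply/eqP/eqv=> //; apply: f_ann.
split; last exact: iff_trans annK (iff_sym (sum_imgmx_fullP _ _)).
apply: iff_trans (iff_sym annK); split=> [F0 B BM | K0 f].
  (* A constant [B] killing every f_alpha(A) lifts to some [f] over F with f(alpha) = B; [F0] makes
     this [f] zero. *)
  have coord := adjoin_root_polyP m_neq0 halpha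
    (splitting_finField_adjoin_root hirr hK halpha).
  have [f lt_fm fB] := horner_map_mx_surj coord B.
  have : f \in pred1 0 by rewrite -F0; apply/annF; rewrite fB.
  by rewrite -fB inE => /eqP->; rewrite rmorph0 horner0.
apply/idP/idP=> [/annF[lt_fm /K0] | ].
  (* Conversely [K0] gives f(alpha) = 0, and injectivity below degree s gives f = 0. *)
  by rewrite inE => /(horner_map_mx_inj hirr halpha lt_fm)->.
rewrite inE => /eqP->; apply/annF; rewrite rmorph0 size_poly0 size_poly_gt0.
by split=> // A _; rewrite horner0 mul0r.
Qed.
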